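(* For every integer $m\ge 3$, $$\hat{r}(2K_2,4P_m)=\min\{4m+1,\,5m-5\}=\begin{cases} 5m-5, & m=3,4,5,\\ 4m+1, & m\ge 6.\end{cases}$$
   Context: All graphs are finite and simple. The size $e(F)$ of a graph $F$ is its number of edges. For graphs $F,G,H$, write $F\to(G,H)$ if for every coloring of the edges of $F$ with the colors red and blue, $F$ contains either a subgraph isomorphic to $G$ all of whose edges are red, or a subgraph isomorphic to $H$ all of whose edges are blue (subgraphs are not necessarily induced). The size Ramsey number $\hat{r}(G,H)$ is the smallest possible size of a graph $F$ with $F\to(G,H)$. $P_m$ denotes the path on $m$ vertices (with $m-1$ edges), $nP_m$ is the disjoint union of $n$ copies of $P_m$, and $2K_2$ is the disjoint union of two edges (a matching of size 2). *)

(* Defs.v *)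
From mathcomp Require Import all_boot.

Set Implicit Arguments.
Unset Strict Implicit.
Unset Printing Implicit Defensive.

Record sgraph := SGraph {
  svertex :> finType;
  sedge : rel svertex;
  sedge_sym : symmetric sedge;
  sedge_irrefl : irreflexive sedge }.

Definition edges (F : sgraph) : {set {set F}} :=
  [set e | [exists x : F, exists y : F, sedge x y && (e == [set x; y])]].

Definition gsize (F : sgraph) : nat := #|edges F|.

(* The image of an injective edge-preserving map is a subgraph of F, not
   necessarily induced, that is isomorphic to G, and conversely. *)
Definition contains (F G : sgraph) : Prop :=
  exists f : G -> F, injective f /\ (forall x y, sedge x y -> sedge (f x) (f y)).

(* An edge coloring is a map on all sets of vertices, of which only the values
   at the edges of F are ever used; true is red and false is blue. *)
Section ColorClass.
Variables (F : sgraph) (c : {set F} -> bool) (b : bool).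

Definition color_rel : rel F := fun x y => sedge x y && (c [set x; y] == b).

Lemma color_rel_sym : symmetric color_rel.
Proof. by move=> x y; rewrite /color_rel sedge_sym setUC. Qed.

Lemma color_rel_irrefl : irreflexive color_rel.
Proof. by move=> x; rewrite /color_rel sedge_irrefl. Qed.

Definition color_class : sgraph := SGraph color_rel_sym color_rel_irrefl.
End ColorClass.

Definition arrows (F G H : sgraph) : Prop :=
  forall c : {set F} -> bool,
    contains (color_class c true) G \/ contains (color_class c false) H.

Definition is_size_ramsey (G H : sgraph) (n : nat) : Prop :=
  (exists F : sgraph, arrows F G H /\ gsize F = n) /\
  (forall F : sgraph, arrows F G H -> n <= gsize F).

Section Complete.
Variable n : nat.

Definition complete_rel : rel 'I_n := fun i j => i != j.

Lemma complete_rel_sym : symmetric complete_rel.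
Proof. by move=> i j; rewrite /complete_rel eq_sym. Qed.

Lemma complete_rel_irrefl : irreflexive complete_rel.
Proof. by move=> i; rewrite /complete_rel eqxx. Qed.

Definition complete_graph : sgraph := SGraph complete_rel_sym complete_rel_irrefl.
End Complete.

Section Path.
Variable m : nat.

Definition path_rel : rel 'I_m := fun i j => (i.+1 == j) || (j.+1 == i).

Lemma path_rel_sym : symmetric path_rel.
Proof. by move=> i j; rewrite /path_rel orbC. Qed.

Lemma path_rel_irrefl : irreflexive path_rel.
Proof. by move=> i; rewrite /path_rel orbb gtn_eqF. Qed.

Definition path_graph : sgraph := SGraph path_rel_sym path_rel_irrefl.
End Path.

Section Copies.
Variables (n : nat) (G : sgraph).

Definition copies_rel : rel ('I_n * G)%type :=
  fun u v => (u.1 == v.1) && sedge u.2 v.2.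

Lemma copies_rel_sym : symmetric copies_rel.
Proof. by move=> u v; rewrite /copies_rel eq_sym sedge_sym. Qed.

Lemma copies_rel_irrefl : irreflexive copies_rel.
Proof. by move=> u; rewrite /copies_rel sedge_irrefl andbF. Qed.

Definition copies : sgraph := SGraph copies_rel_sym copies_rel_irrefl.
End Copies.

(* Main.v *)
(* Upper bound: 5 P_m and the cycle of length 4m + 1 arrow the pair. Lower
   bound: coloring the star at a vertex v red shows that F - v contains 4 P_m
   for every v. In a tree component carrying a P_m, some vertex x and some copy
   of P_m are such that every copy avoiding x is disjoint from it; adding it to
   a 4 P_m in F - x gives 5 P_m, hence 5m - 5 edges. Otherwise the components
   carrying a P_m are not trees, so they have at least as many edges as
   vertices, and they have at least 4m + 1 vertices because they still contain
   4 P_m after the loss of any vertex. *)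
Require Import Defs.
From mathcomp Require Import all_boot zify.

Set Implicit Arguments.
Unset Strict Implicit.
Unset Printing Implicit Defensive.

(** * Counting edges *)

Definition embedding (F G : sgraph) (f : G -> F) : Prop :=
  injective f /\ (forall x y, sedge x y -> sedge (f x) (f y)).

Lemma set2_inj (T : finType) (x y z t : T) :
  [set x; y] = [set z; t] -> (x = z /\ y = t) \/ (x = t /\ y = z).
Proof.
move=> E; have x2 : x \in [set z; t] by rewrite -E set21.
have y2 : y \in [set z; t] by rewrite -E set22.
have z2 : z \in [set x; y] by rewrite E set21.
have t2 : t \in [set x; y] by rewrite E set22.
by case/set2P: x2 => [Ex|Ex]; case/set2P: y2 => [Ey|Ey];
  case/set2P: z2 => [Ez|Ez]; case/set2P: t2 => [Et|Et]; subst; auto.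
Qed.

Lemma edgesP (F : sgraph) (e : {set F}) :
  reflect (exists x y, sedge x y /\ e = [set x; y]) (e \in edges F).
Proof.
rewrite inE; apply: (iffP existsP) => [[x /existsP[y /andP[xy /eqP->]]]|].
  by exists x, y.
by case=> x [y [xy ->]]; exists x; apply/existsP; exists y; rewrite xy eqxx.
Qed.

Lemma mem_edges (F : sgraph) (x y : F) : sedge x y -> [set x; y] \in edges F.
Proof. by move=> xy; apply/edgesP; exists x, y. Qed.

(** When each edge is oriented in exactly one way, sending [i] to its two ends is a bijection from
    [I] onto the edge set; this counts the edges of concrete graphs. *)
Lemma gsize_oriented (F : sgraph) (I : finType) (a b : I -> F) :
  (forall i, sedge (a i) (b i)) ->
  (forall x y, sedge x y ->
     exists i, (x = a i /\ y = b i) \/ (x = b i /\ y = a i)) ->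
  (forall i j, (a i = a j /\ b i = b j) \/ (a i = b j /\ b i = a j) -> i = j) ->
  gsize F = #|I|.
Proof.
move=> ab surj inj.
have inj2 : injective (fun i => [set a i; b i]).
  by move=> i j /set2_inj /inj.
rewrite /gsize -(card_imset _ inj2); apply: eq_card => e.
apply/edgesP/imsetP => [[x [y [xy ->]]]|[i _ ->]]; last by exists (a i), (b i).
have [i [[-> ->]|[-> ->]]] := surj _ _ xy; exists i => //.
by rewrite setUC.
Qed.

Lemma gsize_contains (F G : sgraph) : contains F G -> gsize G <= gsize F.
Proof.
case=> f [injf homf]; rewrite /gsize -(card_imset _ (imset_inj injf)).
apply/subset_leq_card/subsetP => _ /imsetP[_ /edgesP[x [y [xy ->]]] ->].
by rewrite imsetU !imset_set1 mem_edges ?homf.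
Qed.

Lemma gsize_copies_path (n m : nat) : gsize (copies n (path_graph m.+1)) = n * m.
Proof.
(* Edge [j] of copy [i] runs from vertex [j] (by [widen_ord]) to vertex [j + 1] (by [lift ord0]). *)
rewrite (@gsize_oriented (copies n (path_graph m.+1)) ('I_n * 'I_m)%type
  (fun u => (u.1, widen_ord (leqnSn m) u.2)) (fun u => (u.1, lift ord0 u.2))).
- by rewrite card_prod !card_ord.
- by move=> [i j]; rewrite /= /copies_rel /= /path_rel !eqxx.
- move=> [i j] [i' j'] /andP[/= /eqP <- /orP[] /eqP jj'].
  + have lt_jm : j < m by have := ltn_ord j'; lia.
    exists (i, Ordinal lt_jm); left; split; congr pair; apply/val_inj => /=;
      rewrite ?/bump; lia.
  + have lt_jm : j' < m by have := ltn_ord j; lia.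
    exists (i, Ordinal lt_jm); right; split; congr pair; apply/val_inj => /=;
      rewrite ?/bump; lia.
- move=> [i j] [i' j'] /= [] [] [-> /= E] [E'].
  + by congr pair; apply/val_inj.
  + by move: E E'; rewrite /bump /=; lia.
Qed.

(** * Vertex-critical packings *)

(** Connectedness of the path as an induction principle: from [i], walk up or down one step at a
    time. *)
Lemma path_graph_ind (m : nat) (Q : 'I_m -> Prop) :
  (forall i j, path_rel i j -> Q i -> Q j) -> forall i j, Q i -> Q j.
Proof.
move=> step i j Qi; move: j.
have up : forall k (j : 'I_m), j = i + k :> nat -> Q j.
  elim=> [|k IH] j jE; first by rewrite (_ : j = i) //; apply/val_inj => /=; lia.
  have lt_m : i + k < m by have := ltn_ord j; lia.
  apply: (step (Ordinal lt_m)); last exact: IH.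
  by rewrite /path_rel /=; apply/orP; left; lia.
have down : forall k (j : 'I_m), j + k = i :> nat -> Q j.
  elim=> [|k IH] j jE; first by rewrite (_ : j = i) //; apply/val_inj => /=; lia.
  have lt_m : j.+1 < m by have := ltn_ord i; lia.
  apply: (step (Ordinal lt_m)); last by apply: IH => /=; lia.
  by rewrite /path_rel /=; apply/orP; right; lia.
move=> j; have [ij|ji] := leqP i j.
  by apply: (up (j - i)); lia.
by apply: (down (i - j)); lia.
Qed.

(** Breadth-first search: [d x] is the distance from [x] to the root of its component, and [p] moves
    every non-root to a neighbour nearer to the root. *)
Lemma spanning_forest (T : finType) (e : rel T) : connect_sym e ->
  exists (d : T -> nat) (p : T -> T), forall x,
    (p x = x /\ root e x = x) \/ (e x (p x) /\ d (p x) < d x).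
Proof.
move=> esym.
pose reach x n := [exists t : n.-tuple T, path e x t && (last x t == root e x)].
have exP x : exists n, reach x n.
  have /connectP[s xs ls] := connect_root e x.
  exists (size s); apply/existsP; exists (in_tuple s).
  by rewrite /= xs -ls eqxx.
pose d x := ex_minn (exP x).
pose p x := if root e x == x then x else odflt x [pick y | e x y & d y < d x].
exists d, p => x; rewrite /p; have [|rx] := eqVneq; [by left | right].
case: pickP => [y /andP[]//|no].
suff [y /andP[xy dy]] : exists y, e x y && (d y < d x) by have := no y; rewrite /= xy dy.
have [k kx dx] : exists2 k, reach x k & d x = k.
  by rewrite /d; case: ex_minnP => k; exists k.
have /existsP[[s /= /eqP sz] /andP[xs /eqP lst]] := kx.
case: s xs lst sz => [_ E|y s /andP[xy ys] /= lst sz].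
  by rewrite -E eqxx in rx.
(* [y] comes second on a shortest walk from [x] to the root, and the rest of that walk bounds
   [d y]. *)
exists y; rewrite xy /= dx -sz /d.
case: ex_minnP => l _ /(_ (size s)) le_l; rewrite ltnS; apply: le_l.
apply/existsP; exists (in_tuple s); apply/andP; split; first exact: ys.
by apply/eqP; rewrite /= lst; apply/rootP => //; apply: connect1.
Qed.

Section Forest.
Variables (F : sgraph) (d : F -> nat) (p : F -> F).
Hypothesis forestP : forall x, p x = x \/ (sedge x (p x) /\ d (p x) < d x).

(** [fconnect p y x] encodes that [x] is an ancestor of [y]; each application of [p] fixes a vertex
    or lowers its depth. *)
Lemma ancestor_depth (y x : F) : fconnect p y x -> y = x \/ d x < d y.
Proof.
move=> /iter_findex; move: (findex _ _ _) => k <-.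
elim: k => [|k IH]; [by left|rewrite iterS].
case: (forestP (iter k p y)) => [->//|[_ lt]]; right.
by case: IH => [{2}->//|]; apply: ltn_trans.
Qed.

Lemma ancestor_parent (y x : F) :
  fconnect p y x -> y = x \/ fconnect p (p y) x.
Proof.
move=> /iter_findex; move: (findex _ _ _) => [|k] <-; first by left.
by right; rewrite iterSr fconnect_iter.
Qed.

(* Among the copies of the path in the tree component of z, take one whose
   highest vertex x is as deep as possible: a copy meeting the subtree of x
   and avoiding x would stay strictly below x. *)
Lemma tree_component_cut (m : nat) (z : F) (g0 : path_graph m -> F) (i0 : 'I_m) :
  (forall a b, connect (@sedge F) z a -> sedge a b -> b = p a \/ a = p b) ->
  embedding g0 -> connect (@sedge F) z (g0 i0) ->
  exists (x : F) (g : path_graph m -> F), embedding g /\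
    forall g' : path_graph m -> F, embedding g' -> (forall i, g' i != x) ->
      forall i j, g i <> g' j.
Proof.
move=> tree emb0 z0.
have comp (g : path_graph m -> F) i : embedding g -> connect (@sedge F) z (g i) ->
    forall j, connect (@sedge F) z (g j).
  move=> [_ hom] zi j.
  apply: (@path_graph_ind _ (fun j => connect (@sedge F) z (g j)) _ i) => // a b ab za.
  by apply: (connect_trans za); apply/connect1/hom.
(* A path stays in the subtree of its highest vertex: a step to a child remains inside, and a step
   to a parent could leave only from that vertex, towards a smaller depth. *)
have low (g : path_graph m -> F) i : embedding g -> connect (@sedge F) z (g i) ->
    (forall j, d (g i) <= d (g j)) -> forall j, fconnect p (g j) (g i).
  move=> emb zi mini j.
  apply: (@path_graph_ind _ (fun j => fconnect p (g j) (g i)) _ i) => // a b ab.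
  have sab : sedge (g a) (g b) by apply: emb.2.
  case: (tree _ _ (comp _ _ emb zi a) sab) => E; last first.
    by apply: connect_trans; rewrite E fconnect1.
  case/ancestor_parent => [Ea|]; last by rewrite -E.
  case: (forestP (g a)) => [Ef|[_]]; first by rewrite E Ef sedge_irrefl in sab.
  by rewrite -E Ea ltnNge mini.
have embP (g : {ffun 'I_m -> F}) :
  reflect (@embedding F (path_graph m) g)
   (injectiveb g && [forall i, forall j, path_rel i j ==> sedge (g i) (g j)]).
  apply: (iffP andP) => -[].
    move=> /injectiveP inj /forallP hom; split=> // i j ij.
    by have /forallP/(_ j)/implyP := hom i; apply.
  move=> inj hom; split; first exact/injectiveP.
  by apply/forallP => i; apply/forallP => j; apply/implyP/hom.
(* Pairs of a copy and the index of its highest vertex; finite functions make them a finite type, so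
   that a deepest one exists. *)
pose P (q : {ffun 'I_m -> F} * 'I_m) := [&& injectiveb q.1 &&
  [forall i, forall j, path_rel i j ==> sedge (q.1 i) (q.1 j)],
  connect (@sedge F) z (q.1 q.2) & [forall j, d (q.1 q.2) <= d (q.1 j)]].
have top (g : path_graph m -> F) i : embedding g -> connect (@sedge F) z (g i) ->
    exists j, P (finfun g, j).
  move=> emb zi; case: (arg_minnP (fun j => d (g j)) (erefl : predT i)) => j _ minj.
  exists j; apply/and3P; split => /=.
  + apply/embP; split=> [a b|a b ab]; rewrite !ffunE; first exact: emb.1.
    exact: emb.2.
  + by rewrite ffunE; exact: (comp _ _ emb zi j).
  + by apply/forallP => k; rewrite !ffunE minj.
have [j0 P0] := top _ _ emb0 z0.
case: (arg_maxnP (fun q : {ffun 'I_m -> F} * 'I_m => d (q.1 q.2)) P0).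
move=> [g i] /and3P[/= /embP emb zi /forallP mini] maxd.
exists (g i), g; split=> // g' emb' avoid k l E.
have gk := low _ _ emb zi mini k.
have zl : connect (@sedge F) z (g' l) by rewrite -E; exact: (comp _ _ emb zi k).
have below j : fconnect p (g' j) (g i).
  apply: (@path_graph_ind _ (fun j => fconnect p (g' j) (g i)) _ l).
    move=> a b ab; have sab : sedge (g' a) (g' b) by apply: emb'.2.
    case: (tree _ _ (comp _ _ emb' zl a) sab) => E'; last first.
      by apply: connect_trans; rewrite E' fconnect1.
    case/ancestor_parent => [Ea|]; last by rewrite -E'.
    by have := avoid a; rewrite Ea eqxx.
  by rewrite -E.
(* The highest vertex of [g'] is a descendant of [g i] other than [g i], hence deeper, against the
   choice of [g]. *)
have [j Pj] := top _ _ emb' zl.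
have := maxd _ Pj; rewrite /= ffunE => le_d.
case: (ancestor_depth (below j)) => [Ej|]; last by rewrite ltnNge le_d.
by have := avoid j; rewrite Ej eqxx.
Qed.

End Forest.

Lemma embedding_copy (F G : sgraph) (n : nat) (f : copies n G -> F) (k : 'I_n) :
  embedding f -> @embedding F G (fun i => f (k, i)).
Proof.
move=> [inj hom]; split=> [i j /inj[]//|i j ij].
by apply: hom; rewrite /= /copies_rel eqxx.
Qed.

Lemma contains_copiesS (F G : sgraph) (n : nat) (f : copies n G -> F) (g : G -> F) :
  embedding f -> embedding g -> (forall i u, g i <> f u) ->
  contains F (copies n.+1 G).
Proof.
move=> [injf homf] [injg homg] dis.
exists (fun u => if unlift ord0 u.1 is Some k then f (k, u.2) else g u.2); split.
- move=> [k i] [l j] /=.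
  case: (unliftP ord0 k) => [k' ->|->]; case: (unliftP ord0 l) => [l' ->|->].
  + by move=> /injf[-> ->].
  + by move=> /esym/dis.
  + by move=> /dis.
  + by move=> /injg->.
- move=> [k i] [l j] /andP[/= /eqP<- ij].
  case: unliftP => [k' _|_]; last exact: homg.
  by apply: homf; rewrite /= /copies_rel eqxx.
Qed.

(* If no tree component carries a P_m, the components carrying one have at
   least as many edges as vertices: assign to a non-root its parent edge and
   to a root an edge of its component outside the spanning forest. *)
Lemma critical_packing (F : sgraph) (n m : nat) (v0 : F) :
  0 < n -> 0 < m ->
  (forall v : F, exists f : copies n (path_graph m) -> F,
     embedding f /\ forall u, f u != v) ->
  contains F (copies n.+1 (path_graph m)) \/ n * m < gsize F.
Proof.
move=> n0 m0 crit.
have csym : connect_sym (@sedge F) by apply/sym_connect_sym/sedge_sym.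
have [d [p forest]] := spanning_forest csym.
(* [q] is an edge outside the forest in the component of [x]; thus [U] collects the vertices of the
   non-tree components. *)
pose extra x (q : F * F) :=
  [&& connect (@sedge F) x q.1, sedge q.1 q.2, q.2 != p q.1 & q.1 != p q.2].
pose U := [set x | [exists q, extra x q]].
have outU (f : copies n (path_graph m) -> F) u : embedding f -> f u \notin U ->
    contains F (copies n.+1 (path_graph m)).
  case: u => k i emb; rewrite inE negb_exists => /forallP noextra.
  have [||||x [g [embg cut]]] :=
    @tree_component_cut F d p _ m (f (k, i)) (fun i => f (k, i)) i.
  - by move=> x; case: (forest x) => [[]|]; auto.
  - move=> a b xa ab; have := noextra (a, b); rewrite /extra /= xa ab /=.
    by rewrite negb_and !negbK => /orP[] /eqP; auto.
  - exact: embedding_copy.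
  - exact: connect0.
  have [f' [emb' avoid]] := crit x.
  apply: (contains_copiesS emb' embg) => j [l j'].
  exact: (cut _ (embedding_copy l emb')).
pose u0 : copies n (path_graph m) := (Ordinal n0, Ordinal m0).
have [f0 [emb0 _]] := crit v0.
have [U0|nU0] := boolP (f0 u0 \in U); last by left; apply: outU nU0.
(* This packing misses a vertex of [U]; if it lies inside [U], then [U] has at least [n * m + 1]
   vertices. *)
have [f [emb avoid]] := crit (f0 u0).
have [/forallP fU|/forallPn[u nUu]] :=
  boolP [forall u : copies n (path_graph m), f u \in U]; last first.
  by left; apply: outU nUu.
right; apply: (@leq_trans #|U|).
  rewrite (cardsD1 (f0 u0)) U0 ltnS.
  have <- : #|copies n (path_graph m)| = n * m by rewrite card_prod !card_ord.
  rewrite -(card_codom emb.1); apply/subset_leq_card/subsetP => _ /codomP[u ->].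
  by rewrite in_setD1 avoid fU.
pose spec x (e : {set F}) :=
  (p x = x /\ root (@sedge F) x = x /\ exists2 q, extra x q & e = [set q.1; q.2])
  \/ (sedge x (p x) /\ d (p x) < d x /\ e = [set x; p x]).
have /fin_all_exists[phi phiP] : forall x, exists e, x \in U -> spec x e.
  move=> x; have [xU|] := boolP (x \in U); last by exists set0.
  case: (forest x) => [[px rx]|[xp dx]]; last by exists [set x; p x]; right.
  move: xU; rewrite inE => /existsP[q qP].
  by exists [set q.1; q.2] => _; left; split=> //; split=> //; exists q.
(* Two roots with the same edge share a component; a non-forest edge is no parent edge; and two
   vertices cannot each be the parent of the other, by depth. *)
have injphi : {in U &, injective phi}.
  move=> x y /phiP[[px [rx [[a b] qx ->]]]|[xp [dx ->]]]
             /phiP[[py [ry [[a' b'] qy ->]]]|[yp [dy ->]]] /=.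
  - move/and4P: qx => /= [xa ab _ _]; move/and4P: qy => /= [ya ab' _ _] E.
    have xy : connect (@sedge F) x y.
      have xb := connect_trans xa (connect1 ab).
      rewrite csym; case: (set2_inj E) => [[Ea _]|[_ Eb]].
        by apply: connect_trans ya _; rewrite -Ea csym.
      by apply: connect_trans ya _; rewrite -Eb csym.
    by rewrite -rx -ry; apply/rootP.
  - move/and4P: qx => /= [_ _ ba ab] E; exfalso.
    by case: (set2_inj E) => [] [Ea Eb]; rewrite Ea Eb eqxx in ba ab.
  - move/and4P: qy => /= [_ _ ba ab] E; exfalso.
    by case: (set2_inj E) => [] [Ea Eb]; rewrite -Ea -Eb eqxx in ba ab.
  - case/set2_inj => [[]//|[Ex Ey]].
    by rewrite Ey in dx; rewrite -Ex in dy; lia.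
rewrite -(card_in_imset injphi).
apply/subset_leq_card/subsetP => _ /imsetP[x xU ->].
case: (phiP x xU) => [[_ [_ [q /and4P[_ ab _ _] ->]]]|[xp [_ ->]]];
  exact: mem_edges.
Qed.

(** * Arrowing a matching of two edges *)

Section Matching.
Variables (F : sgraph) (c : {set F} -> bool).
Notation K2x2 := (copies 2 (complete_graph 2)).

Lemma red_matching (x y z t : F) :
  sedge x y -> sedge z t -> c [set x; y] -> c [set z; t] ->
  uniq [:: x; y; z; t] -> contains (color_class c true) K2x2.
Proof.
move=> xy zt cxy czt un.
pose f (u : K2x2) : F := nth x [:: x; y; z; t] (2 * u.1 + u.2).
exists f; split=> [[i j] [k l]|[i j] [k l]] /=.
  move/eqP; rewrite /f nth_uniq //= => [/eqP E||].
  + by congr pair; apply/val_inj => /=; have := ltn_ord j; have := ltn_ord l; lia.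
  + by have := ltn_ord j; have := ltn_ord i; lia.
  + by have := ltn_ord k; have := ltn_ord l; lia.
rewrite /copies_rel /complete_rel /= => /andP[/eqP<-].
case: i j l => [[|[|//]] ?] [[|[|//]] ?] [[|[|//]] ?] //= _; rewrite /f /color_rel /=.
all: by rewrite 1?(sedge_sym y) 1?(sedge_sym t) ?xy ?zt 1?(setUC [set y])
  1?(setUC [set t]) ?cxy ?czt.
Qed.

End Matching.

(** Color red exactly the edges at [v]: any two of them meet, so there is a blue [H], whose edges
    avoid [v]. Only an isolated vertex of [H] could still land on [v]. *)
Lemma arrows_matching_cut (F H : sgraph) :
  arrows F (copies 2 (complete_graph 2)) H ->
  forall v : F, exists f : H -> F, embedding f /\
    forall x y, sedge x y -> f x != v.
Proof.
move=> arr v; case: (arr (fun e => v \in e)) => [] [f [inj hom]].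
  have star i : exists j, f (i, j) = v.
    have /andP[_ /eqP] : color_rel (fun e => v \in e) true (f (i, ord0)) (f (i, ord_max)).
      by apply: hom; rewrite /= /copies_rel eqxx.
    by case/set2P => ->; [exists ord0|exists ord_max].
  have [[j0 E0] [j1 E1]] := (star ord0, star ord_max).
  by move: E0; rewrite -E1 => /inj[].
exists f; split.
  by split=> // x y /hom /andP[].
by move=> x y /hom /andP[_ /eqP]; rewrite !inE eq_sym => /negbT/norP[].
Qed.

Lemma copies_path_neighbor (n m : nat) (u : copies n (path_graph m)) :
  1 < m -> exists v, sedge u v.
Proof.
case: u => k j m1; have [jm|mj] := ltnP j.+1 m.
  by exists (k, Ordinal jm); rewrite /= /copies_rel /= /path_rel /= !eqxx.
have lt_m : j.-1 < m by have := ltn_ord j; lia.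
exists (k, Ordinal lt_m); rewrite /= /copies_rel /= /path_rel /= !eqxx /=.
by apply/orP; right; lia.
Qed.

(** Red edges in two different copies form a red matching; otherwise dropping the one copy that may
    hold red edges leaves [n] blue copies. *)
Lemma arrows_copiesS (n : nat) (G : sgraph) :
  arrows (copies n.+1 G) (copies 2 (complete_graph 2)) (copies n G).
Proof.
move=> c; pose red k := [exists x : G, exists y : G,
  sedge x y && c [set (k, x); (k, y)]].
have [[i [j [ij /existsP[x /existsP[y /andP[xy cxy]]]
    /existsP[z /existsP[t /andP[zt czt]]]]]]|noij] :
    (exists i j, [/\ i != j, red i & red j]) \/
    (exists i, forall j, j != i -> ~~ red j).
- have [/existsP[i ri]|/existsPn no] := boolP [exists i, red i]; last first.
    by right; exists ord0.
  have [/existsP[j /andP[ij rj]]|/existsPn no] :=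
    boolP [exists j, (i != j) && red j]; first by left; exists i, j.
  right; exists i => j ji; apply/negP => rj.
  by have := no j; rewrite eq_sym ji rj.
- left; apply: (@red_matching (copies n.+1 G) c (i, x) (i, y) (j, z) (j, t)) => //.
  + by rewrite /= /copies_rel eqxx.
  + by rewrite /= /copies_rel eqxx.
  + rewrite /= !inE !xpair_eqE !eqxx (negPf ij) /= orbF andbT.
    by apply/andP; split; apply/eqP => E; rewrite E sedge_irrefl in xy zt.
- have [i blue] := noij; right.
  exists (fun u => (lift i u.1, u.2)); split.
    by move=> [k x] [l y] /= E; rewrite (lift_inj (congr1 fst E)) (congr1 snd E : x = y).
  move=> [k x] [l y] /andP[/= /eqP<- xy].
  rewrite /color_rel /= /copies_rel eqxx xy /=.
  have ki : lift i k != i by rewrite eq_sym neq_lift.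
  have /existsPn/(_ x)/existsPn/(_ y) := blue _ ki.
  by rewrite xy eqbF_neg.
Qed.

(** * Cycles *)

Section Cycle.
Variable N : nat.

(** The conjunct [i != j] rules out the loop that [ordS] would create when [N = 1]. *)
Definition cycle_rel : rel 'I_N := fun i j => (i != j) && ((j == ordS i) || (i == ordS j)).

Lemma cycle_rel_sym : symmetric cycle_rel.
Proof. by move=> i j; rewrite /cycle_rel eq_sym orbC. Qed.

Lemma cycle_rel_irrefl : irreflexive cycle_rel.
Proof. by move=> i; rewrite /cycle_rel eqxx. Qed.

Definition cycle_graph : sgraph := SGraph cycle_rel_sym cycle_rel_irrefl.

Lemma val_iter_ordS (k : nat) (i : 'I_N) : iter k (@ordS N) i = (i + k) %% N :> nat.
Proof.
elim: k => [|k IH]; first by rewrite addn0 modn_small.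
by rewrite iterS /= IH -addn1 modnDml addn1 addnS.
Qed.

Lemma iter_ordS_inj (k l : nat) (i : 'I_N) :
  k < N -> l < N -> iter k (@ordS N) i = iter l (@ordS N) i -> k = l.
Proof.
move=> kN lN /(congr1 val) /=; rewrite !val_iter_ordS => /eqP.
by rewrite eqn_modDl !modn_small // => /eqP.
Qed.

Lemma ordS_edge (i : 'I_N) : 1 < N -> @sedge cycle_graph i (ordS i).
Proof.
move=> N1; rewrite /= /cycle_rel eqxx andbT.
by apply/eqP => /(@iter_ordS_inj 0 1 i) E; have := E (ltnW N1) N1.
Qed.

Lemma gsize_cycle : 2 < N -> gsize cycle_graph = N.
Proof.
move=> N2; rewrite (@gsize_oriented cycle_graph 'I_N id (@ordS N)) ?card_ord //.
- by move=> i; apply: ordS_edge; lia.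
- by move=> x y /andP[_ /orP[]/eqP->]; [exists x|exists y]; auto.
(* An edge obtained in both orientations would give [j + 2 = j] modulo [N], excluded by [2 < N]. *)
- move=> i j [[]//|[-> E]].
  by have := @iter_ordS_inj 2 0 j N2 (ltnW (ltnW N2)) E.
Qed.

(* Two red edges must meet, so the red edges share a vertex v; going round the
   cycle from the successor of v gives a blue path on the other vertices. *)
Lemma arrows_cycle (n m : nat) : 3 < N -> n * m < N ->
  arrows cycle_graph (copies 2 (complete_graph 2)) (copies n (path_graph m)).
Proof.
move=> N3 nmN c; pose red (i : 'I_N) := c [set i; ordS i].
have N0 : 0 < N by lia.
pose i0 := Ordinal N0.
(* The edges starting at [i] and [i + k] are disjoint for [k] from 2 to [N - 2]. *)
have meet i k : red i -> red (iter k (@ordS N) i) -> 1 < k -> k.+1 < N ->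
    contains (color_class (F := cycle_graph) c true) (copies 2 (complete_graph 2)).
  move=> ri rk k1 kN; apply: (red_matching _ _ ri rk); try by apply: ordS_edge; lia.
  have -> : [:: i; ordS i; iter k (@ordS N) i; ordS (iter k (@ordS N) i)] =
    [seq iter l (@ordS N) i | l <- [:: 0; 1; k; k.+1]] by [].
  rewrite map_inj_in_uniq /=.
    rewrite !inE; lia.
  move=> a b aS bS; apply: iter_ordS_inj.
    by move: aS; rewrite !inE; lia.
  by move: bS; rewrite !inE; lia.
have reach (i j : 'I_N) : exists2 k, k < N & j = iter k (@ordS N) i.
  exists ((j + (N - i)) %% N); first exact: ltn_pmod.
  apply/val_inj; rewrite /= val_iter_ordS modnDmr.
  have -> : i + (j + (N - i)) = j + N by have := ltn_ord i; lia.
  by rewrite modnDr modn_small.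
suff [m2|[v blue]] : contains (color_class (F := cycle_graph) c true)
    (copies 2 (complete_graph 2)) \/
    exists v, forall i, red i -> i = v \/ ordS i = v.
- by left.
(* The copies are laid end to end at the positions 1 to [n * m] after [v]; since [n * m < N], they
   never return to [v]. *)
- right; pose f (u : copies n (path_graph m)) : cycle_graph :=
    iter (u.1 * m + u.2).+1 (@ordS N) v.
  have lt_pos (u : copies n (path_graph m)) : (u.1 * m + u.2).+1 < N.
    case: u => k j /=; have := ltn_ord k; have := ltn_ord j; nia.
  have stepf (k : 'I_n) (i j : 'I_m) : i.+1 = j ->
      @sedge (color_class (F := cycle_graph) c false) (f (k, i)) (f (k, j)).
    move=> ij; have -> : f (k, j) = ordS (f (k, i)) by rewrite /f /= -ij addnS.
    rewrite /= /color_rel ordS_edge ?eqbF_neg /=; last by lia.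
    apply/negP => /blue[].
      by move/(@iter_ordS_inj _ 0) => E; have := E (lt_pos (k, i)) N0.
    rewrite /f -iterS => /(@iter_ordS_inj _ 0) E; have := E _ N0.
    by have := lt_pos (k, j); rewrite /= -ij addnS => lt /(_ lt).
  exists f; split.
    move=> [k i] [l j] /iter_ordS_inj E.
    have {}E := E (lt_pos (k, i)) (lt_pos (l, j)); move: E => /= [E].
    have m0 : 0 < m by have := ltn_ord i; lia.
    have := congr1 (fun x => x %/ m) E; have := congr1 (fun x => x %% m) E.
    rewrite /= !modnMDl !divnMDl // !modn_small // !divn_small // !addn0.
    by move=> /val_inj-> /val_inj->.
  move=> [k i] [l j] /andP[/= /eqP<- /orP[] /eqP ij]; first exact: stepf.
  by rewrite color_rel_sym; exact: (stepf _ _ _ ij).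
have [/existsP[i ri]|/existsPn no] := boolP [exists i, red i]; last first.
  by right; exists i0 => i ri; have := no i; rewrite ri.
pose i' := iter N.-1 (@ordS N) i.
have Si' : ordS i' = i.
  rewrite -iterS prednK //; apply/val_inj; rewrite /= val_iter_ordS modnDr.
  by rewrite modn_small.
have near j : red j -> contains (color_class (F := cycle_graph) c true)
    (copies 2 (complete_graph 2)) \/ [|| j == i', j == i | j == ordS i].
  move=> rj; have [[|[|k]] kN Ej] := reach i j.
  - by right; rewrite Ej eqxx orbT.
  - by right; rewrite Ej eqxx !orbT.
  have [kN'|kN'] := ltnP k.+3 N.
    by left; apply: (meet i k.+2 ri) => //; rewrite -Ej.
  by right; rewrite Ej (_ : k.+2 = N.-1) ?eqxx; lia.
have [/existsP[j /andP[rj far]]|/existsPn no] :=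
  boolP [exists j, red j && ~~ [|| j == i', j == i | j == ordS i]].
  by left; case: (near j rj) => // nj; rewrite nj in far.
have {}near j : red j -> [\/ j = i', j = i | j = ordS i].
  by move=> rj; have := no j; rewrite rj negbK => /or3P[] /eqP; constructor.
(* The red edges are now among three consecutive ones, the outer two being disjoint as [3 < N]; if
   one outer edge is blue, the remaining two share an end of the middle edge. *)
have [ri'|nri'] := boolP (red i').
  have [ri2|nri2] := boolP (red (ordS i)).
    by left; apply: (meet i' 2 ri') => //; rewrite /= Si'.
  right; exists i => j rj; case: (near j rj) => E; first by right; rewrite E.
    by left.
  by rewrite E (negPf nri2) in rj.
right; exists (ordS i) => j rj; case: (near j rj) => E.
- by rewrite E (negPf nri') in rj.
- by right; rewrite E.
- by left.
Qed.

End Cycle.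

(** * The size Ramsey number of a 2-matching against four paths *)

Theorem proposition3p5 (m : nat) (hm : 3 <= m) :
  is_size_ramsey (copies 2 (complete_graph 2)) (copies 4 (path_graph m))
    (minn (4 * m + 1) (5 * m - 5)) /\
  minn (4 * m + 1) (5 * m - 5) = (if m <= 5 then 5 * m - 5 else 4 * m + 1).
Proof.
have size5 : gsize (copies 5 (path_graph m)) = 5 * m - 5.
  by rewrite -(@prednK m) ?gsize_copies_path; lia.
split; last by case: leqP; lia.
split=> [|F arr].
  have [le|lt] := leqP (5 * m - 5) (4 * m + 1).
    by exists (copies 5 (path_graph m)); split; [exact: arrows_copiesS|exact: size5].
  by exists (cycle_graph (4 * m + 1)); split; [apply: arrows_cycle|apply: gsize_cycle]; lia.
have cut (v : F) : exists f : copies 4 (path_graph m) -> F,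
    embedding f /\ forall u, f u != v.
  have [f [emb avoid]] := arrows_matching_cut arr v; exists f; split=> // u.
  have [w uw] := copies_path_neighbor u (ltnW hm).
  exact: avoid uw.
(* Under any coloring [F] contains a nonempty graph, so it has a vertex. *)
have [v0 _] : exists v0 : F, true.
  case: (arr (fun=> false)) => [] [f _]; first by exists (f (ord0, ord0)).
  by exists (f (ord0, Ordinal (ltnW (ltnW hm)))).
rewrite geq_min.
case: (@critical_packing F 4 m v0 isT (ltnW (ltnW hm)) cut) => [/gsize_contains|lt].
  by rewrite size5 => ->; rewrite orbT.
by rewrite addn1 lt.
Qed.
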